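(* Let $C>0$, $0<\alpha<\beta<2$, and let $(X,d)$ be a metric space that satisfies the $n$-dimensional $(C,\alpha,\beta)$-integral tetrahedral property at $p\in X$ for radius $r>0$. Let $\beta'=\max\{1-\alpha,\beta-1\}$. Then $(X,d)$ satisfies the $n$-dimensional $(C',\beta')$-integral tetrahedral property at $p$ for radius $r$, for some constant $C'>0$.
   Context: For a metric space $(X,d)$ with metric completion $\bar X$ (and $d$ extended to $\bar X$), $q\in\bar X$ and $t>0$, put $S(q;t)=\{x\in X: d(x,q)=t\}$. Given $p\in X$, $r>0$, $p_1,\dots,p_{n-1}\in\bar X$ and $t_1,\dots,t_{n-1}>0$, let $S=S(p;r)\cap S(p_1;t_1)\cap\dots\cap S(p_{n-1};t_{n-1})$, and let $h(p,r,t_1,\dots,t_{n-1})=\inf\{d(x,y):x\ne y,\ x,y\in S\}$ if $|S|\ge2$ and $0$ otherwise. For $C>0$, $0<\alpha<\beta<2$, $(X,d)$ satisfies the $n$-dimensional $(C,\alpha,\beta)$-integral tetrahedral property at $p$ for radius $r$ if there exist $p_1,\dots,p_{n-1}\in\bar X$ with $d(p,p_i)=r$ such that $$\int_{\alpha r}^{\beta r}\!\cdots\int_{\alpha r}^{\beta r}h(p,r,t_1,\dots,t_{n-1})\,dt_1\cdots dt_{n-1}\ \ge\ C(\beta-\alpha)^{n-1}r^n .$$ For $C>0$, $\beta\in(0,1)$, $(X,d)$ satisfies the $n$-dimensional $(C,\beta)$-integral tetrahedral property at $p$ for radius $r$ if there exist $p_1,\dots,p_{n-1}\in\bar X$ with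 $d(p,p_i)=r$ such that $$\int_{(1-\beta)r}^{(1+\beta)r}\!\cdots\int_{(1-\beta)r}^{(1+\beta)r}h(p,r,t_1,\dots,t_{n-1})\,dt_1\cdots dt_{n-1}\ \ge\ C(2\beta)^{n-1}r^n .$$ *)

(* Defs.v *)
From HB Require Import structures.
From mathcomp Require Import all_boot all_order all_algebra generic_quotient lra.
From mathcomp Require Import all_classical all_reals all_analysis.
Import Order.TTheory GRing.Theory Num.Theory.
Import numFieldNormedType.Exports.

Set Implicit Arguments.
Unset Strict Implicit.
Unset Printing Implicit Defensive.

Local Open Scope classical_set_scope.
Local Open Scope ring_scope.
Local Open Scope quotient_scope.

(* The metric completion, as Cauchy sequences modulo vanishing distance. *)

Definition cauchy_sequence (R : realType) (X : metricType R) : Type :=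
  {u : nat -> X | cauchy (u @ \oo)}.

HB.instance Definition _ (R : realType) (X : metricType R) :=
  gen_eqMixin (cauchy_sequence X).
HB.instance Definition _ (R : realType) (X : metricType R) :=
  gen_choiceMixin (cauchy_sequence X).

Definition cseq_dist (R : realType) (X : metricType R)
    (u v : cauchy_sequence X) : R :=
  limn (fun k => mdist (sval u k) (sval v k)).

Section CompletionConstruction.
Context {R : realType} (X : metricType R).
Implicit Types u v w : cauchy_sequence X.

Lemma cauchy_mdistP (u : nat -> X) : cauchy (u @ \oo) <->
  forall e, 0 < e ->
    exists N, forall i j, (N <= i)%N -> (N <= j)%N -> mdist (u i) (u j) < e.
Proof.
split.
- move=> /cauchyP cu e e0.
  have [x [N _ H]] := cu _ (divr_gt0 e0 (ltr0n _ 2)).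
  exists N => i j Ni Nj.
  have := H i Ni; have := H j Nj; rewrite /= !ballEmdist /= => xj xi.
  rewrite (splitr e); apply: le_lt_trans (metric_triangle _ x _) _.
  by rewrite ltrD// metric_sym.
- move=> H; apply: cauchy_exP => e e0.
  have [N HN] := H e e0; exists (u N); exists N => // i /= Ni.
  by rewrite ballEmdist /=; apply: HN.
Qed.

Lemma mdist4 (x y x' y' : X) :
  `|mdist x y - mdist x' y'| <= mdist x x' + mdist y y'.
Proof.
have := metric_triangle x x' y; have := metric_triangle x' y' y.
have := metric_triangle x' x y'; have := metric_triangle x y y'.
rewrite (metric_sym x' x) (metric_sym y' y) ler_distl.
by move=> *; apply/andP; split; lra.
Qed.

Lemma cseq_dist_cvg u v :
  (fun k => mdist (sval u k) (sval v k)) @ \oo --> cseq_dist u v.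
Proof.
apply: cauchy_cvg; apply: cauchy_exP => e e0.
have e20 : 0 < e / 2 by rewrite divr_gt0.
have [N HN] := (cauchy_mdistP _).1 (svalP u) _ e20.
have [M HM] := (cauchy_mdistP _).1 (svalP v) _ e20.
pose K := maxn N M.
exists (mdist (sval u K) (sval v K)), K => // i /= Ki.
rewrite /ball /=; apply: le_lt_trans (mdist4 _ _ _ _) _.
rewrite (splitr e) ltrD//.
- exact: HN (leq_maxl N M) (leq_trans (leq_maxl N M) Ki).
- exact: HM (leq_maxr N M) (leq_trans (leq_maxr N M) Ki).
Qed.

Arguments cseq_dist_cvg : clear implicits.

Lemma cseq_distxx u : cseq_dist u u = 0.
Proof.
rewrite /cseq_dist (_ : (fun _ => _) = cst 0) ?lim_cst//.
by apply/funext => k; rewrite mdistxx.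
Qed.

Lemma cseq_dist_sym u v : cseq_dist u v = cseq_dist v u.
Proof.
rewrite /cseq_dist; under eq_fun do rewrite metric_sym.
by [].
Qed.

Lemma cseq_dist_triangle u v w :
  cseq_dist u w <= cseq_dist u v + cseq_dist v w.
Proof.
have h := @cvgD _ _ _ _ eventually_filter _ _ _ _
  (cseq_dist_cvg u v) (cseq_dist_cvg v w).
apply: (ler_cvg_to (cseq_dist_cvg u w) h).
by apply: nearW => k; apply: metric_triangle.
Qed.

Lemma cseq_dist_ge0 u v : 0 <= cseq_dist u v.
Proof.
apply: (ler_cvg_to (cvg_cst 0) (cseq_dist_cvg u v)).
by apply: nearW => k; apply: mdist_ge0.
Qed.

Definition cseq_equiv : rel (cauchy_sequence X) :=
  fun u v => cseq_dist u v == 0.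

Lemma cseq_equiv_refl : reflexive cseq_equiv.
Proof. by move=> u; rewrite /cseq_equiv cseq_distxx. Qed.

Lemma cseq_equiv_sym : symmetric cseq_equiv.
Proof. by move=> u v; rewrite /cseq_equiv cseq_dist_sym. Qed.

Lemma cseq_equiv_trans : transitive cseq_equiv.
Proof.
move=> v u w /eqP uv /eqP vw; rewrite /cseq_equiv eq_le cseq_dist_ge0 andbT.
by apply: le_trans (cseq_dist_triangle u v w) _; rewrite uv vw addr0.
Qed.

Canonical cseq_equiv_equivRel :=
  EquivRel cseq_equiv cseq_equiv_refl cseq_equiv_sym cseq_equiv_trans.

End CompletionConstruction.

Definition completion (R : realType) (X : metricType R) : Type :=
  {eq_quot @cseq_equiv R X}.

HB.instance Definition _ (R : realType) (X : metricType R) :=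
  Choice.on (completion X).
HB.instance Definition _ (R : realType) (X : metricType R) :=
  EqQuotient.on (completion X).

(* Independent of the representatives: see [completion_distE]. *)
Definition completion_dist (R : realType) (X : metricType R)
    (p q : completion X) : R := cseq_dist (repr p) (repr q).

Section CompletionMetric.
Context {R : realType} (X : metricType R).
Implicit Types (u v : cauchy_sequence X) (p q : completion X).

Lemma completion_distE u v :
  completion_dist (\pi_(completion X) u) (\pi_(completion X) v)
  = cseq_dist u v.
Proof.
have E w : cseq_dist (repr (\pi_(completion X) w)) w = 0.
  apply/eqP; have := reprK (\pi_(completion X) w).
  by move/(@eqmodP _ (@cseq_equiv_equivRel R X)).
apply/eqP; rewrite eq_le /completion_dist; apply/andP; split.
- apply: le_trans (cseq_dist_triangle _ u _) _; rewrite E add0r.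
  apply: le_trans (cseq_dist_triangle _ v _) _.
  by rewrite [X in _ + X]cseq_dist_sym E addr0.
- apply: le_trans (cseq_dist_triangle _ (repr (\pi_(completion X) u)) _) _.
  rewrite cseq_dist_sym E add0r.
  apply: le_trans (cseq_dist_triangle _ (repr (\pi_(completion X) v)) _) _.
  by rewrite E addr0.
Qed.

Lemma completion_distxx p : completion_dist p p = 0.
Proof. exact: cseq_distxx. Qed.

Lemma completion_dist_positivity p q : completion_dist p q = 0 -> p = q.
Proof.
by move=> pq; rewrite -(reprK p) -(reprK q); apply/eqmodP/eqP.
Qed.

Lemma completion_dist_sym p q : completion_dist p q = completion_dist q p.
Proof. exact: cseq_dist_sym. Qed.

Lemma completion_dist_triangle q p p' :
  completion_dist p p' <= completion_dist p q + completion_dist q p'.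
Proof. exact: cseq_dist_triangle. Qed.

HB.instance Definition _ := @isMetric.Build R (completion X)
  (@completion_dist R X) completion_distxx completion_dist_positivity
  completion_dist_sym completion_dist_triangle.

End CompletionMetric.

Lemma cauchy_cst (R : realType) (X : metricType R) (x : X) :
  cauchy ((fun=> x : X) @ \oo).
Proof. by apply/cauchy_mdistP => e e0; exists 0%N => i j _ _; rewrite mdistxx. Qed.

Definition to_completion (R : realType) (X : metricType R) (x : X) :
    completion X :=
  \pi_(completion X) (exist _ (fun=> x) (cauchy_cst x)).

Section CompletionTheory.
Context {R : realType} (X : metricType R).

Lemma to_completion_isometry (x y : X) :
  mdist (to_completion x) (to_completion y) = mdist x y.
Proof.
transitivity (completion_dist (to_completion x) (to_completion y)) => //.
by rewrite completion_distE /cseq_dist /= lim_cst.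
Qed.

Lemma to_completion_le (u : cauchy_sequence X) (e : R) (x : X) (N : nat) :
  (forall k, (N <= k)%N -> mdist x (sval u k) <= e) ->
  mdist (to_completion x) (\pi_(completion X) u) <= e.
Proof.
move=> H.
have -> : mdist (to_completion x) (\pi_(completion X) u) =
  completion_dist (to_completion x) (\pi_(completion X) u) by [].
rewrite completion_distE.
set v := exist _ _ _.
have h : (fun=> e) @ \oo --> e by exact: cvg_cst.
by apply: (ler_cvg_to (@cseq_dist_cvg R X v u) h); exists N.
Qed.

Lemma to_completion_dense : dense (range (@to_completion R X)).
Proof.
move=> O [q Oq] oO.
have /nbhs_ballP[e /= e0 He] : nbhs q O by apply: open_nbhs_nbhs.
have [N HN] := (cauchy_mdistP _).1 (svalP (repr q)) _ (divr_gt0 e0 (ltr0n _ 2)).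
exists (to_completion (sval (repr q) N)); split; last by exists (sval (repr q) N).
apply: He; rewrite ballEmdist /= metric_sym -[q in mdist _ q]reprK.
apply: (@le_lt_trans _ _ (e / 2)); last by rewrite ltr_pdivrMr ?ltr_pMr ?ltr1n.
by apply: (to_completion_le (N := N)) => k Nk; rewrite ltW// HN.
Qed.

Lemma completion_complete (F : set_system (completion X)) :
  ProperFilter F -> cauchy F -> exists q : completion X, F --> q.
Proof.
move=> FF /cauchyP cF.
have inv0 (k : nat) : 0 < k.+1%:R^-1 :> R by rewrite invr_gt0 ltr0n.
have /choice[u Hu] : forall k : nat, exists x : X,
    F (ball (to_completion x) (k.+1%:R^-1 : R)).
  move=> k; have [q Fq] := cF _ (divr_gt0 (inv0 k) (ltr0n _ 2)).
  have nq : (ball q (k.+1%:R^-1 / 2 : R))° !=set0.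
    by exists q; apply: nbhsx_ballx; rewrite divr_gt0.
  have [z [qx [x _ xE]]] := to_completion_dense nq (@open_interior _ _).
  rewrite -xE in qx.
  exists x; apply: filterS Fq => y; apply: ball_splitr.
  exact: interior_subset qx.
have uE i j : mdist (u i) (u j) < i.+1%:R^-1 + j.+1%:R^-1 :> R.
  have [y []] := filter_ex (filterI (Hu i) (Hu j)).
  rewrite !ballEmdist /= => yi yj; rewrite -to_completion_isometry.
  apply: le_lt_trans (metric_triangle _ y _) _.
  by rewrite ltrD// metric_sym.
have small (e : R) : 0 < e ->
    exists N, forall k, (N <= k)%N -> k.+1%:R^-1 < e.
  move=> e0; have [N _ HN] := near_infty_natSinv_lt (PosNum e0).
  by exists N => k Nk; apply: HN.
have cu : cauchy (u @ \oo).
  apply/cauchy_mdistP => e e0.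
  have [N HN] := small _ (divr_gt0 e0 (ltr0n _ 2)).
  exists N => i j Ni Nj; apply: lt_trans (uE i j) _.
  by rewrite (splitr e) ltrD// HN.
pose q := \pi_(completion X) (exist _ u cu : cauchy_sequence X).
exists q; apply/metricType_numDomainType.fcvgrPdist_lt => e e0.
have [N HN] := small _ (divr_gt0 e0 (ltr0n _ 3)).
apply: filterS (Hu N) => y; rewrite ballEmdist /= => Ny.
have qN : mdist (to_completion (u N)) q <= e / 3 + e / 3.
  apply: (to_completion_le (N := N)) => k Nk /=.
  by apply/ltW/(lt_trans (uE N k)); rewrite ltrD// HN.
rewrite metric_sym in qN.
apply: le_lt_trans (metric_triangle _ (to_completion (u N)) _) _.
move: Ny qN (HN N (leqnn N)); set a := mdist _ y; set b := mdist q _.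
by move: (N.+1%:R^-1) a b => s a b *; lra.
Qed.

End CompletionTheory.

Section IntegralTetrahedralProperty.
Context {R : realType} {X : metricType R}.

Definition sphere (q : completion X) (t : R) : set X :=
  [set x | mdist (to_completion x) q = t].

Definition sphere_meet (m : nat) (p : X) (r : R) (ps : m.-tuple (completion X))
    (t : m.-tuple R) : set X :=
  sphere (to_completion p) r `&`
  \bigcap_(i in [set: 'I_m]) sphere (tnth ps i) (tnth t i).

Definition min_separation (S : set X) : R :=
  if pselect (exists x y, [/\ S x, S y & x <> y]) then
    inf [set d | exists x y, [/\ x <> y, S x, S y & d = mdist x y]]
  else 0.

Definition tetrahedral_h (m : nat) (p : X) (ps : m.-tuple (completion X))
    (r : R) (t : m.-tuple R) : R := min_separation (sphere_meet p r ps t).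

(* The innermost integration variable is t_1, as in dt_1 ... dt_m. No
   measurability is required: on a nonnegative F each integral is the supremum
   of the integrals of the simple functions below it, the usual value when F is
   measurable. *)
Fixpoint iterated_integral (a b : R) (m : nat) :
    (m.-tuple R -> \bar R) -> \bar R :=
  match m with
  | 0 => fun F => F [tuple]
  | m'.+1 => fun F => iterated_integral a b (fun t : m'.-tuple R =>
      (\int[lebesgue_measure]_(s in `[a, b]) F [tuple of s :: t])%E)
  end.

Definition integral_tetrahedral (n : nat) (C alpha beta : R) (p : X) (r : R) :
    Prop :=
  [/\ 0 < C, 0 < alpha, alpha < beta, beta < 2 &
  exists ps : n.-1.-tuple (completion X),
    (forall i, mdist (to_completion p) (tnth ps i) = r) /\
    ((C * (beta - alpha) ^+ n.-1 * r ^+ n)%:E <=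
     iterated_integral (alpha * r) (beta * r)
       (fun t => (tetrahedral_h p ps r t)%:E))%E].

Definition integral_tetrahedral_sym (n : nat) (C beta : R) (p : X) (r : R) :
    Prop :=
  [/\ 0 < C, 0 < beta, beta < 1 &
  exists ps : n.-1.-tuple (completion X),
    (forall i, mdist (to_completion p) (tnth ps i) = r) /\
    ((C * (2 * beta) ^+ n.-1 * r ^+ n)%:E <=
     iterated_integral ((1 - beta) * r) ((1 + beta) * r)
       (fun t => (tetrahedral_h p ps r t)%:E))%E].

End IntegralTetrahedralProperty.

(* Main.v *)
Require Import Defs.
From mathcomp Require Import all_boot all_order all_algebra lra.
From mathcomp Require Import all_classical all_reals all_analysis.
Import Order.TTheory GRing.Theory Num.Theory.
Import HBNNSimple.
Local Open Scope ring_scope.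

(** With [beta' = max (1 - alpha) (beta - 1)] the interval
    [[1 - beta', 1 + beta']] contains [[alpha, beta]]; since [h >= 0], its
    iterated integral can only grow, and
    [C' = C ((beta - alpha) / (2 beta'))^(n-1)] absorbs the change of
    normalisation. *)

(* Measurability is avoided by comparing directly the simple functions that lie
   below the integrands. *)
Lemma ge0_subset_le_integral d (T : measurableType d) (R : realType)
    (mu : {measure set T -> \bar R}) (A B : set T) (f g : T -> \bar R) :
  (A `<=` B)%classic -> (forall x, 0 <= f x)%E -> (forall x, f x <= g x)%E ->
  (\int[mu]_(x in A) f x <= \int[mu]_(x in B) g x)%E.
Proof.
move=> AB f0 fg; have g0 x : (0 <= g x)%E := le_trans (f0 x) (fg x).
rewrite !ge0_integralE//; apply: ereal_sup_le => _ [h hf <-].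
(* The same simple function is admissible on the right: as [0 <= f <= g], [f] cut off to zero
   outside [A] lies below [g] cut off outside [B]. *)
exists h => // x.
apply: le_trans (hf x) _.
by apply: le_trans (restrict_lee (E := B) _ AB x); [exact: lee_restrict|].
Qed.

(** Induction on [m]: integrating out the innermost variable keeps both the order and the
    nonnegativity. *)
Lemma le_iterated_integral (R : realType) (a b a' b' : R) (m : nat)
    (F G : m.-tuple R -> \bar R) :
  a' <= a -> b <= b' -> (forall t, 0 <= F t)%E -> (forall t, F t <= G t)%E ->
  (iterated_integral a b F <= iterated_integral a' b' G)%E.
Proof.
move=> aa bb; elim: m F G => [|m IH] F G F0 FG /=; first exact: FG.
apply: IH => t; first exact: integral_ge0.
apply: ge0_subset_le_integral => // x /=; rewrite !in_itv /= => /andP[ax xb].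
by rewrite (le_trans aa ax) (le_trans xb bb).
Qed.

Lemma min_separation_ge0 (R : realType) (X : metricType R) (S : set X) :
  0 <= min_separation S.
Proof.
rewrite /min_separation; case: pselect => // -[x [y [Sx Sy xy]]].
apply: lb_le_inf; first by exists (mdist x y), x, y.
by move=> _ [u [v [_ _ _ ->]]]; exact: mdist_ge0.
Qed.

Theorem proposition4p9 (R : realType) (n : nat) (hn : (0 < n)%N)
    (C alpha beta : R) (hC : 0 < C) (halpha : 0 < alpha)
    (halphabeta : alpha < beta) (hbeta : beta < 2)
    (X : metricType R) (p : X) (r : R) (hr : 0 < r)
    (hX : integral_tetrahedral n C alpha beta p r) :
  exists C' : R, 0 < C' /\
    integral_tetrahedral_sym n C' (Num.max (1 - alpha) (beta - 1)) p r.
Proof.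
case: hX => _ _ _ _ [ps [psr hps]].
set b := Num.max _ _.
have ab : 1 - alpha <= b by rewrite le_max lexx.
have bb : beta - 1 <= b by rewrite le_max lexx orbT.
(* Adding [ab] and [bb] gives [0 < beta - alpha <= 2 * b]. *)
have b0 : 0 < b by lra.
have b1 : b < 1 by rewrite gt_max; apply/andP; split; lra.
have C'0 : 0 < C * ((beta - alpha) / (2 * b)) ^+ n.-1.
  by rewrite mulr_gt0// exprn_gt0// divr_gt0 ?mulr_gt0// subr_gt0.
exists (C * ((beta - alpha) / (2 * b)) ^+ n.-1); split => //.
split => //; exists ps; split => //.
(* The powers of [2 * b] cancel, leaving the lower bound of [hps]. *)
rewrite -(mulrA C) -exprMn divfK; last by rewrite mulf_neq0 ?gt_eqF.
apply: le_trans hps _; apply: le_iterated_integral => //.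
- by rewrite ler_pM2r//; lra.
- by rewrite ler_pM2r//; lra.
- by move=> t; rewrite lee_fin; exact: min_separation_ge0.
Qed.
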